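(* Let $\mathfrak a(n,m)$ denote the number of elements of $s^{-1}(\mathrm{Av}_n(132,321))$ with exactly $m$ descents, and let $\mathfrak b(n,m)$ denote the number of elements of $s^{-1}(\mathrm{Av}_n(132,321))$ with exactly $m$ peaks. Then, as formal power series, $$\sum_{n\geq 1}|s^{-1}(\mathrm{Av}_n(132,321))|\,x^n=C(x)-1+x^3(C'(x))^2.$$ Furthermore, $$\sum_{n\geq 1}\sum_{m\geq 0}\mathfrak a(n,m)x^ny^m=F(x,y)+x^3y\left(\frac{\partial}{\partial x}F(x,y)\right)^2$$ and $$\sum_{n\geq 1}\sum_{m\geq 0}\mathfrak b(n,m)x^ny^m=G(x,y)+x^3y\left(\frac{\partial}{\partial x}G(x,y)\right)^2.$$
   Context: $S_n$ is the set of permutations of $\{1,\ldots,n\}$, written as words. The stack-sorting map $s$ is defined recursively on words of distinct positive integers: $s$ sends the empty word to itself, and if $\pi=LNR$ where $N$ is the largest entry of $\pi$, then $s(\pi)=s(L)s(R)N$. Thus $s$ maps $S_n$ to $S_n$, and $s^{-1}(A)=\{\sigma\in S_n: s(\sigma)\in A\}$ for $A\subseteq S_n$. $\mathrm{Av}_n(\tau^{(1)},\ldots,\tau^{(r)})$ is the set of permutations in $S_n$ avoiding (in the classical sense) all the patterns $\tau^{(1)},\ldots,\tau^{(r)}$. A descent of $\pi\in S_n$ is an index $i\in\{1,\ldots,n-1\}$ with $\pi_i>\pi_{i+1}$; a peak is an index $i\in\{2,\ldots,n-1\}$ with $\pi_{i-1}<\pi_i>\pi_{i+1}$. $C_j=\frac1{j+1}\binom{2j}{j}$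 is the $j$-th Catalan number and $C(x)=\sum_{n\ge0}C_nx^n=\frac{1-\sqrt{1-4x}}{2x}$. For integers $i,j\ge 1$, $N(i,j)=\frac1i\binom ij\binom i{j-1}$ and $V(i,j)=2^{i-2j+1}\binom{i-1}{2j-2}C_{j-1}$, with the convention $\binom ab=0$ unless $0\le b\le a$. The generating functions are $$F(x,y)=\sum_{n\geq 1}\sum_{m\geq 1}N(n,m)x^ny^{m-1}=\frac{1-x(y+1)-\sqrt{1-2x(y+1)+x^2(y-1)^2}}{2xy},$$ $$G(x,y)=\sum_{n\geq 1}\sum_{m\geq 1}V(n,m)x^ny^{m-1}=\frac{1-2x-\sqrt{(1-2x)^2-4x^2y}}{2xy}.$$ *)

(* Defs.v *)
From mathcomp Require Import all_boot all_order all_algebra.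

Set Implicit Arguments.
Unset Strict Implicit.
Unset Printing Implicit Defensive.

Import GRing.Theory.

(* A permutation of {1, ..., n} is represented by its word, a [seq nat]. *)
Definition Sn (n : nat) : seq (seq nat) := permutations (iota 1 n).

(* [k] only bounds the recursion depth; the defining recursion is
   [stacksort_nil] and [stacksort_split]. *)
Fixpoint stacksort_rec (k : nat) (w : seq nat) : seq nat :=
  match k, w with
  | 0, _ | _, [::] => [::]
  | k'.+1, _ =>
      let N := \max_(x <- w) x in
      let i := index N w in
      stacksort_rec k' (take i w) ++ stacksort_rec k' (drop i.+1 w) ++ [:: N]
  end.

Definition stacksort (w : seq nat) : seq nat := stacksort_rec (size w) w.

Lemma stacksort_nil : stacksort [::] = [::].
Proof. by []. Qed.

Lemma stacksort_rec_fuel k w :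
  size w <= k -> stacksort_rec k w = stacksort w.
Proof.
rewrite /stacksort; elim/ltn_ind: k w => k IH w lewk.
case: k => [|k] in IH lewk *; first by move: lewk; rewrite leqn0 => /nilP ->.
case: w => [|a w] in lewk *; first by [].
set i := index (\max_(x <- a :: w) x) (a :: w).
have lti : i < size (a :: w).
  rewrite index_mem; have: 0 < size (a :: w) by [].
  elim: (a :: w) => {i IH lewk a w} [//|b [|c w] IHw] _.
    by rewrite big_seq1 mem_head.
  rewrite big_cons /maxn; case: ifP => _; last by rewrite mem_head.
  by rewrite in_cons IHw ?orbT.
have ltk : size w <= k by [].
have le1 : size (take i (a :: w)) <= size w by rewrite size_take lti -ltnS.
have le2 : size (drop i.+1 (a :: w)) <= size w.
  by rewrite size_drop /= subSS leq_subr.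
have E m : size w <= m -> m <= k -> stacksort_rec m.+1 (a :: w) =
    stacksort (take i (a :: w)) ++ stacksort (drop i.+1 (a :: w))
      ++ [:: \max_(x <- a :: w) x].
  move=> lwm lmk; rewrite /= -/i.
  by congr (_ ++ (_ ++ _)); apply: IH => //;
     [exact: leq_trans le1 lwm | exact: leq_trans le2 lwm].
by rewrite (E k) // -(E (size w)).
Qed.

Lemma stacksort_split L N R :
  all (fun x => x < N) (L ++ R) ->
  stacksort (L ++ N :: R) = stacksort L ++ stacksort R ++ [:: N].
Proof.
move=> ltN; have [ltL ltR] : all (ltn^~ N) L /\ all (ltn^~ N) R.
  by move: ltN; rewrite all_cat => /andP[].
have bnd s : all (ltn^~ N) s -> \max_(x <- s) x <= N.
  move=> /allP lts; apply/bigmax_leqP_seq => x xs _; exact/ltnW/lts.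
have maxN : \max_(x <- L ++ N :: R) x = N.
  rewrite big_cat big_cons /=; rewrite (maxn_idPl (bnd R ltR)).
  exact/maxn_idPr/bnd.
have idx : index N (L ++ N :: R) = size L.
  rewrite index_cat ifF /= ?eqxx ?addn0 //.
  by apply/negP => /(allP ltL) /=; rewrite ltnn.
have -> : stacksort (L ++ N :: R) =
          stacksort_rec (size L + size R).+1 (L ++ N :: R).
  by rewrite stacksort_rec_fuel // size_cat /= addnS.
have step k w : stacksort_rec k.+1 (rcons w N ++ R) =
    let M := \max_(x <- rcons w N ++ R) x in
    let i := index M (rcons w N ++ R) in
    stacksort_rec k (take i (rcons w N ++ R)) ++
    stacksort_rec k (drop i.+1 (rcons w N ++ R)) ++ [:: M].
  by case: w.
rewrite -cat_rcons step cat_rcons /= maxN idx.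
have -> : drop (size L).+1 (L ++ N :: R) = R.
  by rewrite -cat_rcons drop_size_cat ?size_rcons.
by rewrite take_size_cat // !stacksort_rec_fuel ?leq_addr ?leq_addl.
Qed.

Definition order_iso (u v : seq nat) : bool :=
  (size u == size v) &&
  [forall i : 'I_(size u), forall j : 'I_(size u),
     (nth 0 u i < nth 0 u j) == (nth 0 v i < nth 0 v j)].

Definition contains (w tau : seq nat) : bool :=
  [exists b : (size w).-tuple bool, order_iso (mask b w) tau].

Definition Av (n : nat) (taus : seq (seq nat)) : seq (seq nat) :=
  [seq w <- Sn n | all (fun tau => ~~ contains w tau) taus].

Definition stacksort_preim (n : nat) (A : seq (seq nat)) : seq (seq nat) :=
  [seq w <- Sn n | stacksort w \in A].

(* Indices are shifted so that the word starts at position 0. *)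
Definition descents (w : seq nat) : nat :=
  count (fun i => nth 0 w i > nth 0 w i.+1) (iota 0 (size w - 1)).

Definition peaks (w : seq nat) : nat :=
  count (fun i => (nth 0 w i < nth 0 w i.+1) && (nth 0 w i.+1 > nth 0 w i.+2))
        (iota 0 (size w - 2)).

Definition preimAv (n : nat) : seq (seq nat) :=
  stacksort_preim n (Av n [:: [:: 1; 3; 2]; [:: 3; 2; 1]]).

Definition fraka (n m : nat) : nat :=
  size [seq w <- preimAv n | descents w == m].

Definition frakb (n m : nat) : nat :=
  size [seq w <- preimAv n | peaks w == m].

Local Open Scope ring_scope.

(* [f n] is the coefficient of x^n. *)
Definition fps := nat -> rat.

Definition fps_X (a : nat) : fps := fun n => (n == a)%:R.
Definition fps_add (f g : fps) : fps := fun n => f n + g n.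
Definition fps_sub (f g : fps) : fps := fun n => f n - g n.
Definition fps_mul (f g : fps) : fps :=
  fun n => \sum_(i < n.+1) f i * g (n - i)%N.
Definition fps_deriv (f : fps) : fps := fun n => f n.+1 *+ n.+1.

(* [f n m] is the coefficient of x^n y^m. *)
Definition fps2 := nat -> nat -> rat.

Definition fps2_XY (a b : nat) : fps2 :=
  fun n m => ((n == a) && (m == b))%:R.
Definition fps2_add (f g : fps2) : fps2 := fun n m => f n m + g n m.
Definition fps2_mul (f g : fps2) : fps2 :=
  fun n m => \sum_(i < n.+1) \sum_(j < m.+1) f i j * g (n - i)%N (m - j)%N.
Definition fps2_derivx (f : fps2) : fps2 := fun n m => f n.+1 m *+ n.+1.

Declare Scope fps_scope.
Delimit Scope fps_scope with fps.
Bind Scope fps_scope with fps.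
Notation "f + g" := (fps_add f g) : fps_scope.
Notation "f - g" := (fps_sub f g) : fps_scope.
Notation "f * g" := (fps_mul f g) : fps_scope.

Declare Scope fps2_scope.
Delimit Scope fps2_scope with fps2.
Bind Scope fps2_scope with fps2.
Notation "f + g" := (fps2_add f g) : fps2_scope.
Notation "f * g" := (fps2_mul f g) : fps2_scope.

Definition catalan (j : nat) : rat := j.+1%:R^-1 * 'C(2 * j, j)%:R.

Definition narayana (i j : nat) : rat :=
  i%:R^-1 * 'C(i, j)%:R * 'C(i, j - 1)%:R.

(* The exponent i - 2j + 1 is an integer; when it is negative (i, j >= 1) the
   binomial coefficient vanishes. *)
Definition Vnum (i j : nat) : rat :=
  2%:R ^ (i%:Z - 2 * j%:Z + 1) * 'C(i - 1, 2 * j - 2)%:R * catalan (j - 1).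

Definition catalan_gf : fps := catalan.

Definition F_gf : fps2 := fun n k => if n == 0%N then 0 else narayana n k.+1.
Definition G_gf : fps2 := fun n k => if n == 0%N then 0 else Vnum n k.+1.

Definition preim_gf : fps :=
  fun n => if n == 0%N then 0 else (size (preimAv n))%:R.
Definition fraka_gf : fps2 :=
  fun n m => if n == 0%N then 0 else (fraka n m)%:R.
Definition frakb_gf : fps2 :=
  fun n m => if n == 0%N then 0 else (frakb n m)%:R.

(* Main.v *)
Require Import Defs.
From mathcomp Require Import all_boot all_order all_algebra.
From mathcomp Require Import ring zify.

(* Give every word [w] a multiplicative weight: at its maximum [w = L N M] the
   weight is [wt L * wt M] times 1, [b], [a] or [u] when, respectively, both, only
   [L], only [M], or none of [L], [M] are empty.  The trivial weight, [y ^ descents] and [y ^ peaks] are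
   of this form.  Let P(v) be the total weight of the preimages of [v] under
   stack-sorting.  Since [s (L N M) = s L ++ s M ++ [N]], P(v) vanishes unless [v]
   ends with its maximum [N], and P(v' N) is the sum of the products
   P(v1) P(v2), suitably weighted, over all [v' = v1 ++ v2].

   The permutations avoiding 132 and 321 are the identity and the words
   [q+1 .. q+p] [1 .. q] [p+q+1 .. n] with [p, q > 0].  Let H and T be the
   generating functions in [x] of P summed over the identities and over the other
   words, and put [s = a + b].  Splitting gives
     H = x (1 + s H + u H^2)   and   T = x (s T + 2 u H T + u x H H'),
   where the last term comes from cutting the first block off.  Differentiating
   the first equation, [x H' (1 - s x - 2 u x H) = H], whence [T = u x^3 H'^2].
   The same identity yields the linear recurrence
     (n+3) H_(n+2) = s (2n+3) H_(n+1) - (s^2 - 4u) n H_n,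
   which the Catalan numbers ([s = 2], [u = 1]), the Narayana polynomials
   ([s = 1 + y], [u = y]) and the polynomials of the V(n, k) ([s = 2], [u = y])
   also satisfy. *)

Set Implicit Arguments.
Unset Strict Implicit.
Unset Printing Implicit Defensive.

Import Order.TTheory GRing.Theory Num.Theory.
Local Open Scope ring_scope.

(** * Power series as polynomials modulo a power of the variable *)

(** Keeping the quotient [r] explicit turns congruences modulo a power of ['X] into equations, which
    can be differentiated and combined by [ring]. *)
Lemma eq_poly_modXn (R : nzRingType) (p q : {poly R}) N :
  (forall i, (i < N)%N -> p`_i = q`_i) -> exists r, p = q + r * 'X^N.
Proof.
move=> eqpq; exists (drop_poly N (p - q)).
have: take_poly N (p - q) = 0.
  apply/polyP => i; rewrite coef_take_poly coef0; case: ifP => // ltiN.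
  by rewrite coefB eqpq ?subrr.
by move: (poly_take_drop N (p - q)) => + E; rewrite E add0r => ->; rewrite addrC subrK.
Qed.

Lemma coef_modXn (R : nzRingType) (p q r : {poly R}) N i :
  p = q + r * 'X^N -> (i < N)%N -> p`_i = q`_i.
Proof. by move=> -> ltiN; rewrite coefD coefMXn ltiN addr0. Qed.

(** Elimination device: [x = y] is a chosen combination of known equations, and [ring] checks that
    its two sides differ by as much as those of the goal. *)
Lemma eq_from_sub (V : zmodType) (x y a b : V) : x = y -> a - b = x - y -> a = b.
Proof. by move=> ->; rewrite subrr => /subr0_eq. Qed.

(* [1 - 'X * e] is invertible modulo ['X^N] by the geometric series. *)
Lemma modXn_cancel (R : comNzRingType) (p q e r : {poly R}) N :
  p * (1 - 'X * e) = q * (1 - 'X * e) + r * 'X^N -> exists r', p = q + r' * 'X^N.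
Proof.
move=> E; have := subrXX 1 ('X * e) N; rewrite expr1n exprMn.
set S := \sum_(i < N) _ => geom.
exists (r * S + (p - q) * e ^+ N).
have {}E : (p - q) * ((1 - 'X * e) * S) = r * 'X^N * S.
  by rewrite mulrA mulrBl E [q * _ + _]addrC addrK.
by move: E; rewrite -geom => /eq_from_sub; apply; ring.
Qed.

(** * The quadratic equation for [H] and the linear equation for [T] *)

Section FunctionalEquations.

Variables (R : comNzRingType) (s u : R) (h : nat -> R).
Hypotheses (h0 : h 0%N = 0)
  (hS : forall n, h n.+1 =
     (n == 0%N)%:R + s * h n + u * \sum_(i < n.+1) h i * h (n - i)%N).

Let H N := \poly_(i < N) h i.

Lemma quadratic_gf N : exists r : {poly R},
  H N = 'X * (1 + s%:P * H N + u%:P * (H N * H N)) + r * 'X^N.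
Proof.
apply: eq_poly_modXn => -[|n] ltnN; rewrite coefXM coef_poly ltnN //=.
rewrite !coefD !coefCM coef1 coefM coef_poly (ltnW ltnN) hS; congr (_ + _ * _).
apply: eq_bigr => i _; rewrite !coef_poly !ifT //; have := ltn_ord i; lia.
Qed.

(** Differentiate the quadratic equation, multiply by ['X] and use the equation itself to replace
    ['X * (1 + s H + u H^2)] by [H]. *)
Lemma deriv_gf n : exists r : {poly R},
  'X * (H n.+1)^`() * (1 - 'X * (s%:P + 2 * u%:P * H n.+1)) =
  H n.+1 + r * 'X^(n.+1).
Proof.
have [r E] := quadratic_gf n.+1.
have E' := congr1 (@deriv R) E.
rewrite !derivE exprS /= in E'.
exists (- r + 'X * r^`() + n.+1%:R * r).
move: E' E; rewrite exprS; set D := (H n.+1)^`(); set p := H n.+1.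
set Y := 'X^n => E' E.
apply: (eq_from_sub (congr2 (fun v w => 'X * v - w) E' E)); ring.
Qed.

(** Multiply [deriv_gf] by [D = 1 - 'X (s + 2 u H)]. By the quadratic equation, [D^2] is congruent
    to the discriminant [(1 - s 'X)^2 - 4 u 'X^2] and [D H] to [(s 'X - 1) H + 2 'X]. What remains
    is linear in [H] and [H'], and its coefficient at [n + 2] is the claim. *)
Lemma quadratic_linear_recurrence n :
  n.+3%:R * h n.+2 =
  s * (n.*2.+3)%:R * h n.+1 - (s ^+ 2 - 4%:R * u) * n%:R * h n.
Proof.
have [r E] := quadratic_gf n.+3.
have [r' E'] := deriv_gf n.+2.
set p := H n.+3 in E E'; set D := 1 - _ in E'.
have : 'X * p^`() * ((1 - s%:P * 'X) ^+ 2 - 4%:R * u%:P * 'X^2) =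
    (s%:P * 'X - 1) * p + 2%:R * 'X +
    (D * r' + 4%:R * u%:P * 'X^2 * p^`() * r + 2%:R * r) * 'X^(n.+3).
  apply: (eq_from_sub (congr2 (fun v w =>
    D * v + (2%:R + 4%:R * u%:P * 'X^2 * p^`()) * w) E' E)).
  by rewrite /D; ring.
move/coef_modXn => /(_ n.+2 (leqnn _)).
have -> : 'X * p^`() * ((1 - s%:P * 'X) ^+ 2 - 4%:R * u%:P * 'X^2) =
   p^`() * 'X - (2 * s)%:P * (p^`() * 'X^2) + (s ^+ 2 - 4%:R * u)%:P * (p^`() * 'X^3).
  rewrite !(rmorphM, rmorphB, rmorphXn) /= !polyC_natr.
  by ring.
have -> : (s%:P * 'X - 1) * p + 2%:R * 'X = s%:P * (p * 'X) - p + 2%:R * 'X.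
  by ring.
rewrite !(coefD, coefN, coefB) !coefCM !mulr_natl !coefMn.
rewrite !(coefXnM, coefMXn, coefMX, coefX) /=.
rewrite !coef_deriv subn2 /=.
(* For [n = 0] the shifted coefficient is cut off, in agreement with the multiple [*+ 0]. *)
have -> : (if (n.+2 < 3)%N then 0 else (p`_(n.+2 - 3).+1) *+ (n.+2 - 3).+1) = p`_n *+ n.
  by case: {+}n => [|k]; rewrite ?mulr0n // ltnNge /= !subSS subn0.
rewrite !coef_poly ltnSn (ltnW (ltnSn _)) ifT; last by lia.
move=> /eq_from_sub; apply; rewrite -muln2.
by ring.
Qed.

Variable t : nat -> R.
Hypotheses (t0 : t 0%N = 0)
  (tS : forall n, t n.+1 = s * t n + u * \sum_(i < n.+1)
     (h i * t (n - i)%N + t i * h (n - i)%N + h i * (h (n - i)%N *+ (n - i)))).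

(** The equation for [T] reads [T D = u 'X^2 H H'] with the [D] of [deriv_gf]. Since [H] is
    congruent to ['X H' D], both sides contain the factor [D], which has constant term 1 and
    cancels. *)
Lemma linear_gf_coef n :
  t n = if (n < 3)%N then 0 else u * \sum_(i < (n - 3).+1)
    (h i.+1 *+ i.+1) * (h (n - 3 - i).+1 *+ (n - 3 - i).+1).
Proof.
case: (ltnP n 3) => [|le3n].
  by move: n => [|[|[|//]]] _; rewrite ?tS ?big_ord_recr ?big_ord0 /= ?t0 ?h0
    ?tS ?big_ord_recr ?big_ord0 /= ?t0 ?h0; ring.
have [r E] := quadratic_gf n.+1.
have [r' E'] := deriv_gf n.
pose T := \poly_(i < n.+1) t i.
have [r'' ET] : exists r'' : {poly R}, T = 'X * (s%:P * T + u%:P *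
    (H n.+1 * T + T * H n.+1 + H n.+1 * ('X * (H n.+1)^`()))) + r'' * 'X^(n.+1).
  apply: eq_poly_modXn => -[|m] ltmn; rewrite coefXM coef_poly ltmn //=.
  rewrite !coefD !coefCM coef_poly (ltnW ltmn) tS !coefD !coefM.
  rewrite -!big_split /=; congr (_ + _ * _).
  apply: eq_bigr => i _; rewrite coefXM coef_deriv !coef_poly.
  have := ltn_ord i; move: (nat_of_ord i) => {}i leim.
  have [-> ->] : (i < n.+1)%N /\ (m - i < n.+1)%N by lia.
  case Ek: (m - i)%N => [|k]; first by rewrite mulr0n.
  by rewrite /= ifT //; lia.
set p := H n.+1 in E E' ET; set D := 1 - _ in E'.
have : T * D = (u%:P * 'X^3 * p^`() ^+ 2) * D +
   (r'' - u%:P * 'X^2 * r' * p^`()) * 'X^(n.+1).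
  apply: (eq_from_sub (congr2 (fun v w => v - u%:P * 'X^2 * p^`() * w) ET E')).
  by rewrite /D; ring.
move=> /modXn_cancel[r3 /coef_modXn] /(_ n (leqnn _)).
rewrite coef_poly ltnSn => ->.
rewrite -mulrA coefCM coefXnM ltnNge le3n /= expr2 coefM; congr (_ * _).
apply: eq_bigr => i _.
by rewrite !coef_deriv !coef_poly !ifT //; have := ltn_ord i; lia.
Qed.

End FunctionalEquations.

(** * Recurrences for the Catalan, Narayana and V numbers *)

(** The factor [n] removes [f 0] from the first instance, so the value at 1 fixes all later ones.
    Hence [f 0] and [g 0] may differ, as they do for [iota_fertility] (0) and [catalan] (1). *)
Lemma linear_recurrence_unique (R : idomainType) (c d f g : nat -> R) :
  (forall n, n.+1%:R != 0 :> R) -> f 1%N = g 1%N ->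
  (forall n, n.+3%:R * f n.+2 = c n * f n.+1 - d n * n%:R * f n) ->
  (forall n, n.+3%:R * g n.+2 = c n * g n.+1 - d n * n%:R * g n) ->
  forall n, f n.+1 = g n.+1.
Proof.
move=> char0 fg1 recf recg n.
suff: f n.+1 = g n.+1 /\ f n.+2 = g n.+2 by case.
elim: n => [|n [IH1 IH2]]; split=> //.
  by apply: (mulfI (char0 2)); rewrite recf recg fg1 !mulr0 !mul0r.
by apply: (mulfI (char0 n.+3)); rewrite recf recg IH1 IH2.
Qed.

(** Valid without [k <= n]; it reduces neighbouring binomials to rational multiples of a single one,
    which [field] can treat as a variable. *)
Lemma natr_binS (n k : nat) :
  'C(n, k.+1)%:R = (n%:R - k%:R) / k.+1%:R * 'C(n, k)%:R :> rat.
Proof.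
have nz : k.+1%:R != 0 :> rat by rewrite pnatr_eq0.
apply: (mulfI nz); rewrite mulrA mulrCA mulfV // mulr1 -natrM mul_bin_left natrM.
have [lekn|ltnk] := leqP k n; first by rewrite natrB.
by rewrite bin_small // !mulr0.
Qed.

(** Clearing the denominator also covers [n = 0], where the inverse takes its default value. *)
Lemma natr_narayana n k : n%:R * narayana n k.+1 = 'C(n, k.+1)%:R * 'C(n, k)%:R.
Proof.
rewrite /narayana subn1 /=; case: n => [|n]; first by rewrite bin0n !mul0r.
by rewrite !mulrA mulfV ?mul1r // pnatr_eq0.
Qed.

Lemma narayanaE n k :
  narayana n.+1 k.+1 = 'C(n.+1, k.+1)%:R * 'C(n.+1, k)%:R / n.+1%:R.
Proof. by rewrite /narayana subn1 -mulrA mulrC. Qed.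

Definition narayana_poly n : {poly rat} := \poly_(k < n) narayana n k.+1.
Definition Vnum_poly n : {poly rat} := \poly_(k < n) Vnum n k.+1.

Lemma coef_narayana_poly n k : (narayana_poly n)`_k = narayana n k.+1.
Proof.
by rewrite coef_poly; case: ltnP => // lenk; rewrite /narayana bin_small ?mulr0n ?mulr0 ?mul0r.
Qed.

(** Stated for successors: truncated subtraction gives [Vnum 0 1] the value 1/2, while [Vnum_poly 0]
    is zero. *)
Lemma coef_Vnum_poly n k : (Vnum_poly n.+1)`_k = Vnum n.+1 k.+1.
Proof.
rewrite coef_poly; case: ltnP => // lenk.
by rewrite /Vnum bin_small ?mulr0n ?mulr0 ?mul0r //; lia.
Qed.

Lemma narayana_poly_recurrence n :
  n.+3%:R * narayana_poly n.+2 =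
  (1 + 'X) * n.*2.+3%:R * narayana_poly n.+1
  - ((1 + 'X) ^+ 2 - 4%:R * 'X) * n%:R * narayana_poly n.
Proof.
have -> : (1 + 'X) * n.*2.+3%:R * narayana_poly n.+1
  - ((1 + 'X) ^+ 2 - 4%:R * 'X) * n%:R * narayana_poly n =
  (narayana_poly n.+1 + narayana_poly n.+1 * 'X) *+ n.*2.+3
  - (narayana_poly n - (narayana_poly n * 'X) *+ 2 + narayana_poly n * 'X * 'X) *+ n.
  by rewrite -muln2; ring.
apply/polyP => k; rewrite mulr_natl !(coefB, coefMn, coefD, coefMX).
rewrite !coef_narayana_poly -muln2.
rewrite -[_ *+ n]mulr_natl mulrDr mulrBr !mulrnAr.
have P m j : 'C(m.+1, j.+1)%:R = 'C(m, j.+1)%:R + 'C(m, j)%:R :> rat.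
  by rewrite binS natrD.
have nz (a m : nat) : (0 < a)%N -> a%:R + m%:R != 0 :> rat.
  by move=> a0; rewrite -natrD pnatr_eq0; lia.
have nz1 m : 1 + m%:R != 0 :> rat := nz 1%N m isT.
(* The quadratic factor shifts indices by up to two, so the two lowest coefficients are separate; in
   the others every binomial becomes a multiple of ['C(n, j)]. *)
case: k => [|[|j]] /=; rewrite !natr_narayana !narayanaE !P ?bin0 ?bin1 ?natr_binS ?bin0.
- by rewrite !mulr0; field; rewrite nz1 nz.
- by field; rewrite nz1 nz.
- by move: 'C(n, j)%:R => b; field; rewrite !nz1 !nz.
Qed.

Lemma catalanS j : catalan j.+1 = (2 * (2 * j + 1))%:R / j.+2%:R * catalan j.
Proof.
rewrite /catalan; have nz (m : nat) : m.+1%:R != 0 :> rat by rewrite pnatr_eq0.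
have -> : (2 * j.+1 = (2 * j).+2)%N by lia.
have E1 : j.+1%:R * 'C((2 * j).+2, j.+1)%:R =
    ((2 * j).+2)%:R * 'C((2 * j).+1, j)%:R :> rat.
  by rewrite -!natrM mul_bin_diag.
have E2 : j.+1%:R * 'C((2 * j).+1, j)%:R = ((2 * j).+1)%:R * 'C(2 * j, j)%:R :> rat.
  rewrite -!natrM; have := mul_bin_down (2 * j).+1 j.
  rewrite subSn ?mul2n -?addnn ?leq_addl // addnK /= => ->.
  by rewrite mulnC.
have -> : 'C((2 * j).+2, j.+1)%:R = 2%:R * 'C((2 * j).+1, j)%:R :> rat.
  by apply: (mulfI (nz j)); rewrite E1; ring.
have -> : 'C((2 * j).+1, j)%:R = (2 * j).+1%:R / j.+1%:R * 'C(2 * j, j)%:R :> rat.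
  by apply: (mulfI (nz j)); rewrite E2 mulrA mulrCA mulfV ?mulr1.
by ring.
Qed.

(** For [s = 2] and [u = 1] the factor [s^2 - 4u] is zero, leaving the two-term recurrence
    [catalanS]. *)
Lemma catalan_recurrence n :
  n.+3%:R * catalan n.+2 =
  2 * n.*2.+3%:R * catalan n.+1 - (2 ^+ 2 - 4%:R * 1) * n%:R * catalan n.
Proof.
have nz : n.+3%:R != 0 :> rat by rewrite pnatr_eq0.
by rewrite catalanS -muln2; field; move: nz; rewrite -addn3 natrD addrC.
Qed.

Lemma VnumE n k : Vnum n.+1 k.+1 = 2 ^ (n%:Z - (2 * k)%:Z) * 'C(n, 2 * k)%:R * catalan k.
Proof.
rewrite /Vnum !subn1 /=; congr (_ * _%:R * _); last by congr 'C(_, _); lia.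
by congr (_ ^ _); lia.
Qed.

Lemma Vnum_poly_recurrence n :
  n.+3%:R * Vnum_poly n.+2 =
  2 * n.*2.+3%:R * Vnum_poly n.+1
  - (2 ^+ 2 - 4%:R * 'X) * n%:R * Vnum_poly n.
Proof.
have -> : 2 * n.*2.+3%:R * Vnum_poly n.+1
  - (2 ^+ 2 - 4%:R * 'X) * n%:R * Vnum_poly n =
  Vnum_poly n.+1 *+ (n * 4 + 6) - (Vnum_poly n - Vnum_poly n * 'X) *+ (4 * n).
  by rewrite -muln2; ring.
apply/polyP => k; rewrite mulr_natl !(coefB, coefMn, coefD, coefMX).
have nz (a m : nat) : (0 < a)%N -> a%:R + m%:R != 0 :> rat.
  by move=> a0; rewrite -natrD pnatr_eq0; lia.
have P m j : 'C(m.+1, j.+1)%:R = 'C(m, j.+1)%:R + 'C(m, j)%:R :> rat.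
  by rewrite binS natrD.
(* The coefficients of [Vnum_poly n] are known for positive [n] only; at [n = 0] they are multiplied
   by zero. *)
case: n => [|m]; rewrite !coef_Vnum_poly !VnumE.
  rewrite mulr0n subr0; case: k => [|k]; first by rewrite !bin0 expr1z expr0z; ring.
  by rewrite !bin_small ?mulr0 ?mul0r ?mul0rn //; lia.
have E1 (z : int) : 2 ^ (m.+1%:Z - z) = 2 ^ (m%:Z - z) * 2%:R :> rat.
  by rewrite -(addn1 m) PoszD addrAC expfzDr.
have E2 (z : int) : 2 ^ (m.+2%:Z - z) = 2 ^ (m%:Z - z) * 4%:R :> rat.
  by rewrite -(addn2 m) PoszD addrAC expfzDr.
case: k => [|j] /=; rewrite !E1 !E2; first by rewrite !bin0; ring.
rewrite catalanS.
have -> : 2 ^ (m%:Z - (2 * j)%:Z) = 2 ^ (m%:Z - (2 * j.+1)%:Z) * 4%:R :> rat.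
  have -> : 4%:R = 2 ^ 2%:Z :> rat by rewrite -exprnP -natrX.
  by rewrite -expfzDr //; congr (_ ^ _); lia.
have -> : (2 * j.+1 = (2 * j).+2)%N by lia.
rewrite !P !natr_binS.
set z := 2 ^ _ => /=; move: z (catalan j) 'C(m, 2 * j)%:R => z c b.
by field; rewrite -natrM (nz 1%N (2 * j)%N isT) !nz.
Qed.

(** * Weighted preimages under stack-sorting *)

Lemma uniq_max_split (w : seq nat) : uniq w -> w != [::] ->
  exists L N R, w = L ++ N :: R /\ all (fun x => (x < N)%N) (L ++ R).
Proof.
elim: w => [//|x w IH] /= /andP[xNw Uw] _.
have [->|/(IH Uw)[L [N [R [Ew ltN]]]]] := eqVneq w [::]; first by exists [::], x, [::].
have [ltxN|ltNx|eqxN] := ltngtP x N.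
- by exists (x :: L), N, R; rewrite Ew /= ltxN.
- exists [::], x, w; split=> //; rewrite Ew /=.
  move: ltN; rewrite !all_cat /= ltNx => /andP[/allP Lx /allP Rx].
  apply/andP; split; apply/allP => y.
    by move=> /Lx /= lty; apply: ltn_trans lty ltNx.
  by move=> /Rx /= lty; apply: ltn_trans lty ltNx.
- by move: xNw; rewrite Ew eqxN mem_cat mem_head orbT.
Qed.

Lemma perm_stacksort (w : seq nat) : uniq w -> perm_eq (stacksort w) w.
Proof.
have [n] := ubnP (size w); elim: n w => // n IH w ltwn Uw.
have [->|/(uniq_max_split Uw)[L [N [R [Ew ltN]]]]] := eqVneq w [::]; first by [].
move: Uw ltwn; rewrite Ew stacksort_split // size_cat cat_uniq /= => Uw ltwn.
have {Uw} [UL UR] : uniq L /\ uniq R by case/and3P: Uw => -> _ /andP[_ ->].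
rewrite catA cats1 perm_rcons.
rewrite -[X in perm_eq _ X]/(L ++ [:: N] ++ R) perm_sym perm_catCA /= perm_cons perm_sym.
by apply: perm_cat; apply: IH => //; lia.
Qed.

Definition sorts_to (v : seq nat) := [seq w <- permutations v | stacksort w == v].

Lemma mem_sorts_to (v w : seq nat) :
  (w \in sorts_to v) = (stacksort w == v) && perm_eq w v.
Proof. by rewrite mem_filter mem_permutations. Qed.

Lemma sorts_to_uniq v : uniq (sorts_to v).
Proof. exact/filter_uniq/permutations_uniq. Qed.

(** Since [s (L N R) = s L ++ s R ++ [N]], a preimage amounts to a cut of [v] and a preimage of each
    part. *)
Lemma sorts_to_rcons (v : seq nat) (N : nat) :
  uniq v -> all (fun x => (x < N)%N) v ->
  perm_eq (sorts_to (rcons v N))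
    [seq x.1 ++ N :: x.2 | i <- index_iota 0 (size v).+1,
       x <- [seq (L, R) | L <- sorts_to (take i v), R <- sorts_to (drop i v)]].
Proof.
move=> Uv ltN; apply: uniq_perm => [||w]; first exact: sorts_to_uniq.
  apply: allpairs_uniq_dep => [|i _|]; first exact: iota_uniq.
    by apply: allpairs_uniq => [||[? ?] [? ?] _ _ [-> ->]] //; apply: sorts_to_uniq.
  move=> p q /allpairsPdep[i' [x' [Hi Hx Ep]]].
  move=> /allpairsPdep[j' [y' [Hj Hy Eq]]]; rewrite {p}Ep {q}Eq /=.
  case/allpairsPdep: Hx => L [R [HL HR ->]] /=.
  case/allpairsPdep: Hy => L' [R' [HL' HR' ->]] /=.
  have notin k A : A \in sorts_to (take k v) -> N \notin A.
    rewrite mem_sorts_to => /andP[_ /perm_mem ->]; apply/negP => /mem_take.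
    by move/(allP ltN); rewrite ltnn.
  have idx A B : N \notin A -> index N (A ++ N :: B) = size A.
    by move=> NA; rewrite index_cat (negPf NA) /= eqxx addn0.
  (* The position of [N] in the word recovers the cut, so no word is listed twice. *)
  move=> E; have := congr1 (index N) E; rewrite !idx ?(notin _ _ HL) ?(notin _ _ HL') // => sLL'.
  have sz k A : k \in index_iota 0 (size v).+1 -> A \in sorts_to (take k v) -> size A = k.
    rewrite mem_index_iota mem_sorts_to => /= lek /andP[_ /perm_size ->].
    by rewrite size_takel.
  have eij : i' = j' by rewrite -(sz _ _ Hi HL) -(sz _ _ Hj HL').
  by move/eqP: E; rewrite eqseq_cat // => /andP[/eqP-> /eqP[->]]; rewrite eij.
rewrite mem_sorts_to; apply/idP/allpairsPdep => [/andP[/eqP sw pw]|].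
  have Uw : uniq w.
    rewrite (perm_uniq pw) rcons_uniq Uv andbT; apply/negP => /(allP ltN).
    by rewrite ltnn.
  have [w0|/(uniq_max_split Uw)[L [M [R [Ew ltM]]]]] := eqVneq w [::].
    by move: pw; rewrite w0 perm_sym => /perm_size /=; rewrite size_rcons.
  move: sw; rewrite Ew stacksort_split // catA cats1 => /rcons_inj[sv EM].
  move: Uw; rewrite Ew cat_uniq /= => /and3P[UL _ /andP[_ UR]].
  have [pL pR] := (perm_stacksort UL, perm_stacksort UR).
  exists (size L), (L, R); split; last by rewrite EM.
    rewrite mem_index_iota /= ltnS -sv size_cat (perm_size pL); exact: leq_addr.
  apply/allpairsPdep; exists L, R; split=> //.
    by rewrite mem_sorts_to -sv -(perm_size pL) take_size_cat // eqxx perm_sym.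
  by rewrite mem_sorts_to -sv -(perm_size pL) drop_size_cat // eqxx perm_sym.
move=> [i [x [Hi /allpairsPdep[L [R [HL HR ->]]] ->]]] /=.
move: HL HR; rewrite !mem_sorts_to => /andP[/eqP sL pL] /andP[/eqP sR pR].
have pLR : perm_eq (L ++ R) v by rewrite -(cat_take_drop i v) perm_cat.
rewrite stacksort_split ?(perm_all _ pLR) // sL sR catA cat_take_drop cats1 eqxx.
rewrite perm_sym perm_rcons perm_sym -[_ :: R]cat1s perm_catCA /=.
by rewrite perm_cons.
Qed.

(** A nonempty stack-sorted word ends with its maximum. *)
Lemma sorts_to_rcons_nil (v : seq nat) (N x : nat) :
  uniq (rcons v N) -> x \in v -> (N < x)%N -> sorts_to (rcons v N) = [::].
Proof.
move=> Uv xv ltNx; apply/eqP; rewrite -size_eq0 -leqn0 leqNgt -has_predT.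
apply/hasPn => w; rewrite mem_sorts_to => /andP[/eqP sw pw].
have Uw : uniq w by rewrite (perm_uniq pw).
have [w0|/(uniq_max_split Uw)[L [M [R [Ew ltM]]]]] := eqVneq w [::].
  by move: pw; rewrite w0 perm_sym => /perm_size /=; rewrite size_rcons.
move: sw; rewrite Ew stacksort_split // catA cats1 => /rcons_inj[_ EM].
have: x \in w by rewrite (perm_mem pw) mem_rcons inE xv orbT.
rewrite Ew EM mem_cat inE orbCA -mem_cat => /predU1P[xN|/(allP ltM)].
  by rewrite xN ltnn in ltNx.
by rewrite EM ltnNge (ltnW ltNx).
Qed.

Section Fertility.

Variables (R : comNzRingType) (a b u : R) (wt : seq nat -> R).

Definition split_weight (m n : nat) : R :=
  if m == 0%N then (if n == 0%N then 1 else b) else (if n == 0%N then a else u).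

Definition multiplicative_weight := wt [::] = 1 /\
  forall L N M, all (fun x => (x < N)%N) (L ++ M) ->
    wt (L ++ N :: M) = split_weight (size L) (size M) * wt L * wt M.

(** For the trivial weight this is the usual fertility, the number of preimages under
    stack-sorting. *)
Definition fertility (v : seq nat) : R := \sum_(w <- sorts_to v) wt w.

Hypothesis wtM : multiplicative_weight.

Lemma fertility_nil : fertility [::] = 1.
Proof. by rewrite /fertility big_seq1 (proj1 wtM). Qed.

Lemma fertility_rcons (v : seq nat) N : uniq v -> all (fun x => (x < N)%N) v ->
  fertility (rcons v N) = \sum_(0 <= i < (size v).+1)
    split_weight i (size v - i) * (fertility (take i v) * fertility (drop i v)).
Proof.
move=> Uv ltN; rewrite /fertility (perm_big _ (sorts_to_rcons Uv ltN)).
rewrite big_allpairs_dep; apply: eq_big_nat => i /andP[_ lei].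
rewrite big_allpairs_dep /= mulr_suml mulr_sumr; apply: eq_big_seq => L.
rewrite mem_sorts_to mulr_sumr mulr_sumr => /andP[_ pL]; apply: eq_big_seq => M.
rewrite mem_sorts_to => /andP[_ pM].
have pLM : perm_eq (L ++ M) v by rewrite -(cat_take_drop i v) perm_cat.
rewrite (proj2 wtM) ?(perm_all _ pLM) // (perm_size pL) (perm_size pM).
by rewrite size_takel // size_drop mulrA.
Qed.

Lemma fertility_rcons0 (v : seq nat) N x : uniq (rcons v N) -> x \in v -> (N < x)%N ->
  fertility (rcons v N) = 0.
Proof. by move=> Uv xv ltNx; rewrite /fertility (sorts_to_rcons_nil Uv xv ltNx) big_nil. Qed.

(** The recursion on the last letter uses only lengths and comparisons, so the value depends only on
    the relative order of the entries. *)
Lemma fertility_map (f : nat -> nat) (v : seq nat) :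
  {homo f : x y / (x < y)%N} -> uniq v -> fertility (map f v) = fertility v.
Proof.
move=> homf; have monof := leqW_mono (leq_mono homf).
have injf : injective f := incn_inj (leq_mono homf).
have [n] := ubnP (size v); elim: n v => // n IH v; case/lastP: v => [//|v N] in IH *.
rewrite size_rcons => ltvn Uv; have := Uv; rewrite rcons_uniq => /andP[NNv Uv'].
rewrite map_rcons; have [ltN|/allPn[x xv]] := boolP (all (fun x => (x < N)%N) v).
  rewrite !fertility_rcons ?map_inj_uniq // ?size_map; last first.
    by rewrite all_map; apply: sub_all ltN => x; rewrite /= monof.
  apply: eq_big_nat => i /andP[_ lei].
  by rewrite -map_take -map_drop !IH ?drop_uniq ?take_uniq ?size_drop ?size_takel //; lia.
rewrite /= -leqNgt leq_eqVlt => /predU1P[Nx|ltNx]; first by rewrite Nx xv in NNv.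
rewrite (fertility_rcons0 Uv xv ltNx) (@fertility_rcons0 _ _ (f x)) ?map_f ?monof //.
by rewrite -map_rcons map_inj_uniq.
Qed.

End Fertility.

(** * Preimages of block words *)

Lemma iota_rcons m n : iota m n.+1 = rcons (iota m n) (m + n)%N.
Proof. by rewrite -[n.+1](addn1 n) iotaD cats1. Qed.

Definition block_word (p q r : nat) : seq nat :=
  iota q.+1 p ++ iota 1 q ++ iota (p + q).+1 r.

Lemma size_block_word p q r : size (block_word p q r) = (p + q + r)%N.
Proof. by rewrite !size_cat !size_iota addnA. Qed.

Lemma mem_block_word p q r x : (x \in block_word p q r) = (0 < x <= p + q + r)%N.
Proof. by rewrite !mem_cat !mem_iota; lia. Qed.

Lemma block_word_uniq p q r : uniq (block_word p q r).
Proof.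
rewrite !cat_uniq !iota_uniq /= !andbT; apply/andP; split; apply/hasPn => x /=.
  by rewrite mem_cat !mem_iota; lia.
by rewrite !mem_iota; lia.
Qed.

Lemma block_word_rcons p q r :
  block_word p q r.+1 = rcons (block_word p q r) (p + q + r).+1.
Proof. by rewrite /block_word iota_rcons -!rcons_cat addSn. Qed.

Section BlockWords.

Variables (R : comNzRingType) (a b u : R) (wt : seq nat -> R).
Hypothesis wtM : multiplicative_weight a b u wt.

Local Notation fert := (fertility wt).
Local Notation tau p q r := (fert (block_word p q r)).
Local Notation id_fert n := (fert (iota 1 n)).

(** The coefficients of [T]. *)
Definition block_fertility (n : nat) : R :=
  \sum_(1 <= p < n.+1) \sum_(1 <= q < (n - p).+1) fertility wt (block_word p q (n - p - q)).

(** The coefficients of [H]. The value 0 at the empty word, whose fertility is 1, restricts the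
    convolutions to cuts with two nonempty parts. *)
Definition iota_fertility (n : nat) : R := if n == 0%N then 0 else fertility wt (iota 1 n).

Lemma sum_split_weight n (F : nat -> R) : (0 < n)%N ->
  \sum_(0 <= i < n.+1) split_weight a b u i (n - i) * F i =
  b * F 0%N + a * F n + u * \sum_(1 <= i < n) F i.
Proof.
move=> n0; rewrite big_nat_recr //= big_ltn // mulr_sumr /split_weight.
rewrite subn0 subnn eqxx gtn_eqF //= -addrA [X in _ + X]addrC addrA.
congr (_ + _); apply: eq_big_nat => i /andP[i0 ltin].
by rewrite !gtn_eqF ?subn_gt0.
Qed.

Lemma sum_endpoints0 n (F : nat -> R) : (0 < n)%N -> F 0%N = 0 -> F n = 0 ->
  \sum_(i < n.+1) F i = \sum_(1 <= i < n) F i.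
Proof.
move=> n0 F0 Fn; rewrite -(big_mkord xpredT F) big_nat_recr //= big_ltn //.
by rewrite F0 Fn add0r addr0.
Qed.

Lemma fertility_iota m n : fert (iota m.+1 n) = fert (iota 1 n).
Proof.
rewrite -addn1 iotaDl (fertility_map wtM) ?iota_uniq //.
by move=> x y; rewrite ltn_add2l.
Qed.

(** Opens a gap of [c] values above [q]; the pieces of a cut block word are images of standard words
    under such maps. *)
Definition shift_above (q c x : nat) : nat := if (x <= q)%N then x else (x + c)%N.

Lemma shift_above_homo q c : {homo shift_above q c : x y / (x < y)%N}.
Proof. by move=> x y; rewrite /shift_above; do 2!case: ifP; lia. Qed.

Lemma map_shift_above_le q c : map (shift_above q c) (iota 1 q) = iota 1 q.
Proof.
by apply: map_id_in => x; rewrite mem_iota /shift_above => ?; rewrite ifT //; lia.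
Qed.

Lemma map_shift_above_gt q c m n : (q < m)%N ->
  map (shift_above q c) (iota m n) = iota (m + c) n.
Proof.
move=> ltqm; rewrite addnC iotaDl; apply/eq_in_map => x; rewrite mem_iota => /andP[lemx _].
by rewrite /shift_above ifF; lia.
Qed.

Lemma fertility_gap q c n : fert (iota 1 q ++ iota (q + c).+1 n) = fert (iota 1 (q + n)).
Proof.
rewrite -[RHS](fertility_map wtM (@shift_above_homo q c)) ?iota_uniq // iotaD map_cat.
by rewrite map_shift_above_le add1n map_shift_above_gt.
Qed.

Lemma fertility_shifted_blocks p q r c :
  fert (iota (q + c).+1 p ++ iota 1 q ++ iota (p + q + c).+1 r) = tau p q r.
Proof.
rewrite -[RHS](fertility_map wtM (@shift_above_homo q c)) ?block_word_uniq //.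
by rewrite !map_cat map_shift_above_le !map_shift_above_gt //; lia.
Qed.

(** With an empty third block the word ends with [q], although it starts with [q + 1]. *)
Lemma fertility_block_word0 p q : (0 < p)%N -> (0 < q)%N -> tau p q 0 = 0.
Proof.
case: p q => [//|p] [//|q] _ _.
have E : block_word p.+1 q.+1 0 = rcons (iota q.+2 p.+1 ++ iota 1 q) q.+1.
  by rewrite /block_word cats0 [in LHS](iota_rcons 1) rcons_cat add1n.
have := block_word_uniq p.+1 q.+1 0; rewrite E => Uw.
by apply: (fertility_rcons0 wt Uw (x := q.+2)); rewrite ?mem_head.
Qed.

(** Each part of a cut identity is a translated identity; the two end cuts give [a + b]. *)
Lemma iota_fertility_rec n : iota_fertility n.+1 =
  (n == 0%N)%:R + (a + b) * iota_fertility n +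
  u * \sum_(i < n.+1) iota_fertility i * iota_fertility (n - i)%N.
Proof.
have -> : iota_fertility n.+1 = fert (rcons (iota 1 n) n.+1) by rewrite -iota_rcons.
rewrite (fertility_rcons wtM) ?iota_uniq //; last first.
  by apply/allP => x; rewrite mem_iota; lia.
rewrite size_iota.
have [->|n0] := posnP n.
  by rewrite big_nat1 big_ord1 /= (fertility_nil wtM) /iota_fertility /split_weight /=; ring.
rewrite sum_split_weight // take0 drop0 take_oversize ?size_iota //.
rewrite drop_oversize ?size_iota // (fertility_nil wtM) mulr0n add0r.
rewrite (@sum_endpoints0 _ (fun i => iota_fertility i * iota_fertility (n - i)%N)) //;
  try by rewrite ?subnn ?mul0r ?mulr0.
rewrite mul1r mulr1 -mulrDl [b + a]addrC; congr (_ + u * _).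
  by rewrite /iota_fertility gtn_eqF.
apply: eq_big_nat => i /andP[i0 ltin].
rewrite take_iota drop_iota (minn_idPl (ltnW ltin)) add1n fertility_iota.
by rewrite /iota_fertility !gtn_eqF ?subn_gt0.
Qed.

(** The products arise from the cut: inside the first block, it leaves an identity and a block word;
    past the second block, a block word and an identity; right after the first block, two
    identities. A cut inside the second block contributes zero. *)
Lemma block_fertility_rec n : block_fertility n.+1 =
  (a + b) * block_fertility n + u * \sum_(i < n.+1)
   (iota_fertility i * block_fertility (n - i)%N + block_fertility i * iota_fertility (n - i)
    + iota_fertility i * (iota_fertility (n - i)%N *+ (n - i))).
Proof.
have block0 : block_fertility 0 = 0 by rewrite /block_fertility big_geq.
have iota0 : iota_fertility 0 = 0 by [].
(* Words with empty third block contribute zero, so the third block can be taken one longer than in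
   length [n]. *)
have -> : block_fertility n.+1 =
    \sum_(1 <= p < n.+1) \sum_(1 <= q < (n - p).+1) tau p q (n - p - q).+1.
  rewrite /block_fertility big_nat_recr //= [X in _ + X]big_geq ?addr0; last by lia.
  apply: eq_big_nat => p /andP[p0 ltpn].
  rewrite subSn // big_nat_recr //= subnn fertility_block_word0 // ?addr0.
  by apply: eq_big_nat => q /andP[q0 ltqn]; rewrite subSn.
have [->|n0] := posnP n.
  by rewrite big_geq // big_ord1 block0 iota0 /=; ring.
rewrite (@sum_endpoints0 _ (fun i => iota_fertility i * block_fertility (n - i)%N +
  block_fertility i * iota_fertility (n - i)%N +
  iota_fertility i * (iota_fertility (n - i)%N *+ (n - i)))) //; first last.
- by rewrite subnn block0 iota0 mulr0n !mulr0 !addr0.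
- by rewrite block0 iota0 !mul0r !addr0.
pose splits i := \sum_(1 <= p < n.+1) \sum_(1 <= q < (n - p).+1)
  fert (take i (block_word p q (n - p - q))) * fert (drop i (block_word p q (n - p - q))).
have -> : \sum_(1 <= p < n.+1) \sum_(1 <= q < (n - p).+1) tau p q (n - p - q).+1 =
    (a + b) * block_fertility n + u * \sum_(1 <= i < n) splits i.
  rewrite exchange_big /= !mulr_sumr -big_split; apply: eq_big_nat => p /andP[p0 ltpn].
  rewrite exchange_big /= !mulr_sumr -big_split; apply: eq_big_nat => q /andP[q0 ltqn].
  have En : (p + q + (n - p - q))%N = n by lia.
  rewrite block_word_rcons (fertility_rcons wtM) ?block_word_uniq //; last first.
    by apply/allP => x; rewrite mem_block_word; lia.
  rewrite size_block_word En sum_split_weight // take0 drop0.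
  rewrite take_oversize ?drop_oversize ?size_block_word ?En // (fertility_nil wtM) /=.
  by rewrite mul1r mulr1 -mulrDl [b + a]addrC.
congr (_ + u * _); apply: eq_big_nat => i /andP[i0 ltin].
have Hi : iota_fertility i = id_fert i by rewrite /iota_fertility gtn_eqF.
have Hni : iota_fertility (n - i)%N = id_fert (n - i)%N.
  by rewrite /iota_fertility gtn_eqF // subn_gt0.
(* The cut at [i] falls after the first block if [p < i], at its end if [p = i], and
   inside it if [p > i]. *)
rewrite /splits (big_cat_nat (n := i)) //=; last by lia.
rewrite [X in _ + X]big_ltn; last by lia.
have -> : \sum_(1 <= p < i) \sum_(1 <= q < (n - p).+1)
    fert (take i (block_word p q (n - p - q))) * fert (drop i (block_word p q (n - p - q)))
    = block_fertility i * iota_fertility (n - i)%N.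
  rewrite /block_fertility big_nat_recr //= subnn [X in _ + X]big_geq // addr0 mulr_suml.
  apply: eq_big_nat => p /andP[p0 ltpi].
  rewrite (big_cat_nat (n := (i - p).+1)) //=; last by lia.
  rewrite [X in _ + X]big_nat_cond [X in _ + X]big1 ?addr0 => [|q /andP[/andP[leq ltq] _]].
    rewrite mulr_suml; apply: eq_big_nat => q /andP[q0 leqip].
    have -> : block_word p q (n - p - q) =
        block_word p q (i - p - q) ++ iota i.+1 (n - i).
      rewrite /block_word -!catA; congr (_ ++ (_ ++ _)).
      have -> : (n - p - q = (i - p - q) + (n - i))%N by lia.
      by rewrite iotaD; congr (_ ++ iota _ _); lia.
    have sz : size (block_word p q (i - p - q)) = i by rewrite size_block_word; lia.
    rewrite -[X in take X]sz -[X in drop X]sz take_size_cat // drop_size_cat //.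
    by rewrite fertility_iota Hni.
  (* The cut falls inside or after the second block, so that the part before it does
     not end with its maximum. *)
  have -> : block_word p q (n - p - q) = (iota ((i - p) + (q - (i - p))).+1 p ++
      iota 1 (i - p) ++ iota (p + (i - p) + (q - (i - p))).+1 0) ++
      iota (i - p).+1 (q - (i - p)) ++ iota (p + q).+1 (n - p - q).
    rewrite cats0 -!catA subnKC; last by lia.
    congr (_ ++ _); rewrite catA; congr (_ ++ _).
    by rewrite -add1n -iotaD; congr (iota _ _); lia.
  rewrite take_size_cat ?fertility_shifted_blocks; last by rewrite !size_cat !size_iota; lia.
  by rewrite fertility_block_word0 ?mul0r ?subn_gt0.
have -> : \sum_(1 <= q < (n - i).+1)
    fert (take i (block_word i q (n - i - q))) * fert (drop i (block_word i q (n - i - q)))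
    = iota_fertility i * (iota_fertility (n - i)%N *+ (n - i)).
  (* After the first block is cut off, the rest closes up to an identity whatever [q] is, so the
     [n - i] values of [q] give equal terms. *)
  rewrite mulrnAr -[X in _ *+ X]subn0 -[X in _ *+ X]subSS -sumr_const_nat.
  apply: eq_big_nat => q /andP[q0 ltqn].
  rewrite take_size_cat ?size_iota // drop_size_cat ?size_iota // addnC.
  by rewrite fertility_iota fertility_gap Hi Hni; congr (_ * fert (iota _ _)); lia.
have -> : \sum_(i.+1 <= p < n.+1) \sum_(1 <= q < (n - p).+1)
    fert (take i (block_word p q (n - p - q))) * fert (drop i (block_word p q (n - p - q)))
    = iota_fertility i * block_fertility (n - i)%N.
  rewrite -add1n big_addn subSn 1?ltnW // /block_fertility mulr_sumr.
  apply: eq_big_nat => p /andP[p0 ltpn].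
  have -> : (n - (p + i) = n - i - p)%N by lia.
  rewrite mulr_sumr; apply: eq_big_nat => q /andP[q0 ltqn].
  have -> : block_word (p + i) q (n - i - p - q) = iota q.+1 i ++
      iota (q + i).+1 p ++ iota 1 q ++ iota (p + q + i).+1 (n - i - p - q).
    rewrite /block_word addnC iotaD -!catA addSn; do 3!congr (_ ++ _).
    by congr (iota _ _); lia.
  rewrite take_size_cat ?size_iota // drop_size_cat ?size_iota //.
  by rewrite fertility_shifted_blocks fertility_iota Hi.
by ring.
Qed.

End BlockWords.

(** * Permutations avoiding 132 and 321 *)

Lemma containsP (w tau : seq nat) :
  reflect (exists2 v, subseq v w & order_iso v tau) (contains w tau).
Proof.
apply: (iffP existsP) => [[m iso]|[v /subseqP[m szm ->] iso]].
  by exists (mask m w); rewrite ?mask_subseq.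
have szm' : size m == size w by rewrite szm.
by exists (Tuple szm').
Qed.

Lemma order_iso_132 (v : seq nat) : order_iso v [:: 1; 3; 2]%N ->
  exists x y z, v = [:: x; y; z] /\ (x < z < y)%N.
Proof.
case: v => [|x [|y [|z [|]]]] // /andP[_ /forallP iso]; exists x, y, z; split=> //.
have /forallP/(_ (Ordinal (isT : 2 < 3)%N))/eqP := iso (Ordinal (isT : 0 < 3)%N).
have /forallP/(_ (Ordinal (isT : 1 < 3)%N))/eqP := iso (Ordinal (isT : 2 < 3)%N).
by move=> /= -> ->.
Qed.

Lemma order_iso_321 (v : seq nat) : order_iso v [:: 3; 2; 1]%N ->
  exists x y z, v = [:: x; y; z] /\ (z < y < x)%N.
Proof.
case: v => [|x [|y [|z [|]]]] // /andP[_ /forallP iso]; exists x, y, z; split=> //.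
have /forallP/(_ (Ordinal (isT : 1 < 3)%N))/eqP := iso (Ordinal (isT : 2 < 3)%N).
have /forallP/(_ (Ordinal (isT : 0 < 3)%N))/eqP := iso (Ordinal (isT : 1 < 3)%N).
by move=> /= -> ->.
Qed.

Lemma order_iso_132_triple x y z : (x < z < y)%N -> order_iso [:: x; y; z] [:: 1; 3; 2]%N.
Proof.
move=> lt; apply/andP; split=> //; apply/forallP => -[[|[|[|//]]] /= ?];
  apply/forallP => -[[|[|[|//]]] /= ?]; lia.
Qed.

Lemma order_iso_321_triple x y z : (z < y < x)%N -> order_iso [:: x; y; z] [:: 3; 2; 1]%N.
Proof.
move=> lt; apply/andP; split=> //; apply/forallP => -[[|[|[|//]]] /= ?];
  apply/forallP => -[[|[|[|//]]] /= ?]; lia.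
Qed.

Lemma subseq_cons_nth (x : nat) v w : subseq (x :: v) w ->
  exists i, [/\ (i < size w)%N, nth 0%N w i = x & subseq v (drop i.+1 w)].
Proof.
elim: w => [//|y w IH] /=; case: eqP => [->|_ /IH[i [ltiw xi sub]]].
  by exists 0%N; rewrite drop0.
by exists i.+1.
Qed.

Lemma subseq3_nth (x y z : nat) w : subseq [:: x; y; z] w ->
  exists i j k, [/\ (i < j < k)%N, (k < size w)%N, nth 0%N w i = x,
    nth 0%N w j = y & nth 0%N w k = z].
Proof.
move=> /subseq_cons_nth[i [ltiw xi /subseq_cons_nth[j [+ + /subseq_cons_nth[k [+ + _]]]]]].
rewrite !drop_drop !size_drop !nth_drop => ltj yj ltk zk.
exists i, (i.+1 + j)%N, (j.+1 + i.+1 + k)%N; split=> //; try lia.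
Qed.

Lemma nth_block_word p q r i : (i < p + q + r)%N -> nth 0%N (block_word p q r) i =
  if (i < p)%N then (q.+1 + i)%N else if (i < p + q)%N then (i - p).+1 else i.+1.
Proof.
move=> lti; rewrite /block_word !nth_cat !size_iota.
case: ltnP => ltip; first by rewrite nth_iota.
by case: ltnP => lt1; case: ltnP => lt2; rewrite ?nth_iota; lia.
Qed.

Lemma block_word_perm p q r : perm_eq (block_word p q r) (iota 1 (p + q + r)).
Proof.
apply: uniq_perm (block_word_uniq p q r) (iota_uniq _ _) _ => x.
by rewrite mem_block_word mem_iota; lia.
Qed.

Local Notation Av132_321 n := (Av n [:: [:: 1; 3; 2]; [:: 3; 2; 1]]%N).

Lemma mem_Av132_321 n (w : seq nat) : reflect
  (perm_eq w (iota 1 n) /\ forall x y z, subseq [:: x; y; z] w ->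
     ~~ (x < z < y)%N && ~~ (z < y < x)%N)
  (w \in Av132_321 n).
Proof.
rewrite mem_filter /= andbT mem_permutations; apply: (iffP andP) => -[H pw].
  split=> // x y z sub; case/andP: H => no132 no321.
  apply/andP; split; [apply: contra no132|apply: contra no321] => lt; apply/containsP.
    by exists [:: x; y; z]; rewrite ?order_iso_132_triple.
  by exists [:: x; y; z]; rewrite ?order_iso_321_triple.
split=> //; apply/andP; split; apply/containsP => -[v sub].
  move=> /order_iso_132[x [y [z [Ev lt]]]]; rewrite Ev in sub.
  by have := pw _ _ _ sub; rewrite lt.
move=> /order_iso_321[x [y [z [Ev lt]]]]; rewrite Ev in sub.
by have := pw _ _ _ sub; rewrite lt andbF.
Qed.

Lemma block_word_Av p q r : block_word p q r \in Av132_321 (p + q + r).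
Proof.
apply/mem_Av132_321; split=> [|x y z]; first exact: block_word_perm.
move=> /subseq3_nth[i [j [k [/andP[ltij ltjk]]]]]; rewrite size_block_word => ltk.
rewrite !nth_block_word; try lia.
by move=> <- <- <-; case: (ltnP i p); case: (ltnP i (p + q)); case: (ltnP j p);
  case: (ltnP j (p + q)); case: (ltnP k p); case: (ltnP k (p + q)); lia.
Qed.

Lemma sorted_ltn_subseq (w : seq nat) :
  (forall x y, subseq [:: x; y] w -> (x < y)%N) -> sorted ltn w.
Proof.
move=> H; rewrite (sorted_pairwise ltn_trans).
elim: w H => //= x w IH H; rewrite IH ?andbT => [|y z sub].
  by apply/allP => y yw; apply: H; rewrite /= eqxx sub1seq.
by apply: H; apply: subseq_trans sub (subseq_cons _ _).
Qed.

(** Write [w = L N R] around its maximum. If [R] is empty, delete [N] and use induction. Otherwise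
    avoiding 132 puts all of [L] above [R], and avoiding 321 makes both [R] (after [N]) and [L]
    (before an entry of [R]) increasing. So [R L N] is the identity, and [w] has blocks [L N] and
    [R] and an empty third block. *)
Lemma Av132_321_block n (w : seq nat) : w \in Av132_321 n ->
  w = iota 1 n \/
  exists p q, [/\ (0 < p)%N, (0 < q)%N, (p + q <= n)%N & w = block_word p q (n - p - q)].
Proof.
move=> /mem_Av132_321; elim: n w => [|n IH] w [pw av].
  by left; apply/eqP; rewrite -size_eq0 (perm_size pw).
have Uw : uniq w by rewrite (perm_uniq pw) iota_uniq.
have [w0|/(uniq_max_split Uw)[L [N [R [Ew ltN]]]]] := eqVneq w [::].
  by move: pw; rewrite w0 => /perm_size.
have EN : N = n.+1.
  have: n.+1 \in w by rewrite (perm_mem pw) mem_iota; lia.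
  have: N \in w by rewrite Ew mem_cat mem_head orbT.
  rewrite (perm_mem pw) mem_iota Ew mem_cat inE orbCA -mem_cat => leN.
  by case/predU1P => [//|/(allP ltN)]; lia.
have [R0|nR0] := eqVneq R [::].
  rewrite R0 cats1 EN in Ew; rewrite R0 cats0 in ltN.
  have pL : perm_eq L (iota 1 n).
    by move: pw; rewrite Ew iota_rcons add1n perm_rcons perm_sym perm_rcons perm_cons perm_sym.
  have avL x y z : subseq [:: x; y; z] L -> ~~ (x < z < y)%N && ~~ (z < y < x)%N.
    by move=> sub; apply: av; rewrite Ew (subseq_trans sub) ?subseq_rcons.
  have [EL|[p [q [p0 q0 lepq EL]]]] := IH L (conj pL avL).
    by left; rewrite Ew EL iota_rcons.
  right; exists p, q; split=> //; first by lia.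
  rewrite Ew EL (_ : n.+1 - p - q = (n - p - q).+1)%N; last by lia.
  by rewrite block_word_rcons; congr rcons; lia.
have gtLR x z : x \in L -> z \in R -> (z < x)%N.
  move=> xL zR; have: subseq [:: x; N; z] w.
    by rewrite Ew -cat1s -[N :: R]cat1s -[[:: N; z]]cat1s !cat_subseq ?sub1seq ?mem_head.
  move=> /av; have ltzN : (z < N)%N by apply: (allP ltN); rewrite mem_cat zR orbT.
  rewrite ltzN andbT => /andP[+ _]; rewrite -leqNgt leq_eqVlt => /predU1P[exz|//].
  move: Uw; rewrite Ew cat_uniq => /and3P[_ /hasPn/(_ z)].
  by rewrite inE zR orbT exz xL => /(_ isT).
have sortedR : sorted ltn R.
  apply: sorted_ltn_subseq => x y sub.
  have: subseq [:: N; x; y] w.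
    by rewrite Ew; apply: (subseq_trans _ (suffix_subseq L _)); rewrite /= eqxx.
  move=> /av; have xR : x \in R by apply: (mem_subseq sub); rewrite mem_head.
  have -> : (x < N)%N by apply: (allP ltN); rewrite mem_cat xR orbT.
  rewrite andbT => /andP[_]; rewrite -leqNgt leq_eqVlt => /predU1P[exy|//].
  have: uniq [:: x; y].
    move: Uw; rewrite Ew cat_uniq /= => /and3P[_ _ /andP[_ UR]]; exact: subseq_uniq sub UR.
  by rewrite exy /= inE eqxx.
have sortedL : sorted ltn L.
  apply: sorted_ltn_subseq => x y sub.
  have [z zR] : exists z, z \in R.
    by case: R nR0 {Ew ltN gtLR sortedR} => [//|z R]; exists z; rewrite mem_head.
  have: subseq [:: x; y; z] w.
    rewrite Ew -[[:: x; y; z]]/([:: x; y] ++ [:: z]).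
    by rewrite cat_subseq ?sub1seq ?inE ?zR ?orbT.
  have yL : y \in L by apply: (mem_subseq sub); rewrite !inE eqxx orbT.
  move=> /av; rewrite (gtLR _ _ yL zR) /= => /andP[_]; rewrite -leqNgt leq_eqVlt.
  move=> /predU1P[exy|//]; have: uniq [:: x; y].
    move: Uw; rewrite Ew cat_uniq /= => /andP[UL _]; exact: subseq_uniq sub UL.
  by rewrite exy /= inE eqxx.
have E : R ++ rcons L N = iota 1 n.+1.
  apply: (irr_sorted_eq ltn_trans ltnn); last first.
  - move=> x; rewrite -(perm_mem pw) Ew !mem_cat mem_rcons !inE.
    by rewrite orbC -orbA orbCA orbA.
  - exact: iota_ltn_sorted.
  rewrite (sorted_pairwise ltn_trans) pairwise_cat -!(sorted_pairwise ltn_trans) sortedR.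
  rewrite (sorted_pairwise ltn_trans) pairwise_rcons -(sorted_pairwise ltn_trans) sortedL.
  move: ltN; rewrite all_cat => /andP[ltL ltR]; rewrite ltL !andbT /=.
  apply/allrelP => x y xR; rewrite mem_rcons inE => /predU1P[->|yL].
    exact: (allP ltR).
  exact: gtLR.
right; exists (size L).+1, (size R); have szE := congr1 size E.
rewrite size_cat size_rcons size_iota in szE; split=> //.
- by case: (R) nR0.
- by lia.
rewrite (_ : _ - _ = 0)%N; last by lia.
have ER : R = iota 1 (size R).
  have := congr1 (take (size R)) E; rewrite take_size_cat // take_iota => ->.
  by rewrite size_iota; congr iota; lia.
have EL : rcons L N = iota (size R).+1 (size L).+1.
  have := congr1 (drop (size R)) E; rewrite drop_size_cat // drop_iota => ->.
  by congr iota; lia.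
by rewrite Ew /block_word cats0 -cat_rcons EL -ER.
Qed.

(** The parameters can be read off the word: its first letter is [q + 1], and the letter 1 has index
    [p]. The identity differs by its first letter 1. *)
Lemma Av132_321E n : perm_eq (Av132_321 n)
  (iota 1 n :: [seq block_word p q (n - p - q) |
     p <- index_iota 1 n.+1, q <- index_iota 1 (n - p).+1]).
Proof.
have head_block p q r : (0 < p)%N -> nth 0%N (block_word p q r) 0 = q.+1.
  by case: p.
have index_block p q r : (0 < q)%N -> index 1%N (block_word p q r) = p.
  case: q => // q _; rewrite /block_word index_cat mem_iota /= addn0 size_iota //.
apply: uniq_perm => [||w]; first exact/filter_uniq/permutations_uniq.
  rewrite /=; apply/andP; split.
    apply/allpairsPdep => -[p [q []]]; rewrite !mem_index_iota => p1 q1 E.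
    have := congr1 (fun w => nth 0%N w 0) E; rewrite head_block; last by lia.
    by case: n p1 q1 {E} => [|n] /=; lia.
  apply: allpairs_uniq_dep => [|p _|]; rewrite ?iota_uniq //.
  move=> x y /allpairsPdep[p [q [Hp Hq Ex]]] /allpairsPdep[p' [q' [Hp' Hq' Ey]]].
  rewrite Ex Ey /= => E; rewrite !mem_index_iota in Hp Hq Hp' Hq'.
  have := congr1 (fun w => nth 0%N w 0) E; rewrite !head_block; try lia.
  have := congr1 (index 1%N) E; rewrite !index_block; try lia.
  by move=> -> [->].
apply/idP/idP => [/Av132_321_block[->|[p [q [p0 q0 lepq ->]]]]|].
- exact: mem_head.
- rewrite inE; apply/orP; right; apply/allpairsPdep; exists p, q.
  by rewrite !mem_index_iota; split=> //; lia.
rewrite inE => /predU1P[->|/allpairsPdep[p [q []]]].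
  by have := block_word_Av n 0 0; rewrite /block_word !cats0 !addn0.
rewrite !mem_index_iota => p1 q1 ->.
have {2}-> : n = (p + q + (n - p - q))%N by lia.
exact: block_word_Av.
Qed.

(** Group the preimages by their image, then list the images by [Av132_321E]. *)
Lemma sum_preimAv (R : comNzRingType) (wt : seq nat -> R) n :
  \sum_(w <- preimAv n) wt w = fertility wt (iota 1 n) + block_fertility wt n.
Proof.
have -> : \sum_(w <- preimAv n) wt w = \sum_(v <- Av132_321 n) fertility wt v.
  rewrite /preimAv /stacksort_preim big_filter.
  have U : uniq (Av132_321 n) by exact/filter_uniq/permutations_uniq.
  transitivity (\sum_(w <- Sn n) \sum_(v <- Av132_321 n | stacksort w == v) wt w).
    rewrite big_mkcond; apply: eq_bigr => w _; case: ifP => wA.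
      rewrite -big_filter (@eq_filter _ _ (pred1 (stacksort w))) //.
      by rewrite ?filter_pred1_uniq ?big_seq1.
    rewrite big_seq_cond big1 // => v /andP[vA /eqP Ev]; by rewrite Ev vA in wA.
  rewrite (exchange_big_dep predT) //= big_seq [RHS]big_seq; apply: eq_bigr => v vA.
  rewrite /fertility big_filter; apply: perm_big; rewrite perm_sym.
  by apply/perm_permutations; case/mem_Av132_321: vA.
by rewrite (perm_big _ (Av132_321E n)) /= big_cons big_allpairs_dep.
Qed.

(** * Descents, peaks and generating functions *)

Lemma descents_cons2 x y w : descents [:: x, y & w] = ((y < x) + descents (y :: w))%N.
Proof. by rewrite /descents /= !subn1 /= (iotaDl 1 0) count_map. Qed.

Lemma peaks_cons3 x y z w :
  peaks [:: x, y, z & w] = (((x < y) && (z < y)) + peaks [:: y, z & w])%N.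
Proof. by rewrite /peaks /= !subn2 /= (iotaDl 1 0) count_map. Qed.

Lemma descents_split (L R : seq nat) N : all (fun x => x < N)%N (L ++ R) ->
  descents (L ++ N :: R) = (descents L + descents R + (R != [::]))%N.
Proof.
elim: L => [|x [|y L] IH] /=.
- by case: R => [//|z R] /= /andP[ltzN _]; rewrite descents_cons2 ltzN addnC.
- by move=> /andP[ltxN ltR]; rewrite descents_cons2 (ltnNge N) ltnW //= IH.
- by move=> /andP[_ ltLR]; rewrite !descents_cons2 IH // !addnA.
Qed.

(** A neighbour of the maximum is never a peak, so the peaks other than [N] are those of [L] and of
    [R] taken separately. *)
Lemma peaks_split (L R : seq nat) N : all (fun x => x < N)%N (L ++ R) ->
  peaks (L ++ N :: R) = (peaks L + peaks R + ((L != [::]) && (R != [::])))%N.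
Proof.
have peaksN M : all (fun x => x < N)%N M -> peaks (N :: M) = peaks M.
  case: M => [//|z [//|z' M]] /= /andP[ltzN _].
  by rewrite peaks_cons3 (ltnNge N) ltnW.
elim: L => [|x [|y [|z L]] IH] /=.
- by move=> ltR; rewrite peaksN // addn0.
- case: R {IH} => [|z R] //= /and3P[ltxN ltzN ltR].
  by rewrite peaks_cons3 ltxN ltzN peaksN /= ?ltzN // addnC.
- move=> /and3P[ltxN ltyN ltR]; rewrite peaks_cons3 (ltnNge N) (ltnW ltyN) andbF IH //.
  by rewrite /= ltyN.
- by move=> /andP[_ ltLR]; rewrite !peaks_cons3 IH // !addnA.
Qed.

Lemma descents_weight :
  multiplicative_weight 1 'X 'X (fun w => 'X^(descents w) : {poly rat}).
Proof.
split=> [|L N M ltN]; rewrite ?expr0 // (descents_split ltN) !exprD /split_weight.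
by case: L M {ltN} => [|x L] [|y M] /=; rewrite ?expr0 ?expr1; ring.
Qed.

Lemma peaks_weight :
  multiplicative_weight 1 1 'X (fun w => 'X^(peaks w) : {poly rat}).
Proof.
split=> [|L N M ltN]; rewrite ?expr0 // (peaks_split ltN) !exprD /split_weight.
by case: L M {ltN} => [|x L] [|y M] /=; rewrite ?expr0 ?expr1; ring.
Qed.

Lemma trivial_weight : multiplicative_weight 1 1 1 (fun w => 1 : rat).
Proof.
split=> // L N M _; rewrite !mulr1 /split_weight.
by case: ifP; case: ifP.
Qed.

(** * Coefficients of [H + u x^3 H'^2] and the three identities *)

Section Assembly.

Variables (R : comNzRingType) (a b u : R) (wt : seq nat -> R).
Hypothesis wtM : multiplicative_weight a b u wt.

Local Notation h := (iota_fertility wt).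

Lemma sum_preimAv_gf n : (0 < n)%N -> \sum_(w <- preimAv n) wt w =
  h n + (if (n < 3)%N then 0 else u * \sum_(i < (n - 3).+1)
    (h i.+1 *+ i.+1) * (h (n - 3 - i).+1 *+ (n - 3 - i).+1)).
Proof.
move=> n0; rewrite sum_preimAv {1}/iota_fertility gtn_eqF //; congr (_ + _).
apply: (linear_gf_coef (s := a + b)) => //; first exact: iota_fertility_rec wtM.
  by rewrite /block_fertility big_geq.
exact: block_fertility_rec wtM.
Qed.

Lemma iota_fertility1 : h 1 = 1.
Proof. by rewrite (iota_fertility_rec wtM) big_ord1 /iota_fertility /=; ring. Qed.

End Assembly.

(** Identifying [H] with a classical sequence thus needs only its linear recurrence and its value at
    1. *)
Lemma iota_fertility_unique (R : idomainType) (a b u : R) wt (g : nat -> R) :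
  multiplicative_weight a b u wt -> (forall n, n.+1%:R != 0 :> R) -> g 1%N = 1 ->
  (forall n, n.+3%:R * g n.+2 = (a + b) * (n.*2.+3)%:R * g n.+1
     - ((a + b) ^+ 2 - 4%:R * u) * n%:R * g n) ->
  forall n, iota_fertility wt n.+1 = g n.+1.
Proof.
move=> wtM char0 g1 recg.
apply: (linear_recurrence_unique char0 _ _ recg); first by rewrite (iota_fertility1 wtM).
by apply: quadratic_linear_recurrence => //; apply: iota_fertility_rec wtM.
Qed.

Lemma coef_sum_Xn (T : Type) (s : seq T) (f : T -> nat) m :
  (\sum_(w <- s) 'X^(f w) : {poly rat})`_m = (size [seq w <- s | f w == m])%:R.
Proof.
rewrite coef_sum size_filter -sum1_count natr_sum [RHS]big_mkcond.
by apply: eq_bigr => w _; rewrite coefXn eq_sym; case: ifP.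
Qed.

Lemma fps2_mul_XY (c d : nat) (f : fps2) n m :
  fps2_mul (fps2_XY c d) f n m =
  if (c <= n)%N && (d <= m)%N then f (n - c)%N (m - d)%N else 0.
Proof.
rewrite /fps2_mul /fps2_XY; case: ifP => [/andP[lecn ledm]|].
  rewrite (bigD1 (Ordinal (lecn : c < n.+1)%N)) //=.
  rewrite (bigD1 (Ordinal (ledm : d < m.+1)%N)) //= !eqxx mul1r.
  rewrite big1 ?addr0 => [|j nej]; last first.
    by rewrite -val_eqE /= in nej; rewrite (negPf nej) andbF mul0r.
  rewrite big1 ?addr0 // => i nei; rewrite big1 // => j _.
  by rewrite -val_eqE /= in nei; rewrite (negPf nei) mul0r.
move=> out; rewrite big1 // => i _; rewrite big1 // => j _.
case: andP => [[/eqP Ei /eqP Ej]|_]; last by rewrite mul0r.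
by move: out; rewrite -Ei -Ej -ltnS ltn_ord -ltnS ltn_ord.
Qed.

Lemma fps_mul_X (c : nat) (f : fps) n :
  fps_mul (fps_X c) f n = if (c <= n)%N then f (n - c)%N else 0.
Proof.
rewrite /fps_mul /fps_X; case: ifP => [lecn|out].
  rewrite (bigD1 (Ordinal (lecn : c < n.+1)%N)) //= eqxx mul1r.
  rewrite big1 ?addr0 // => i nei.
  by rewrite -val_eqE /= in nei; rewrite (negPf nei) mul0r.
rewrite big1 // => i _; case: eqP => [Ei|_]; last by rewrite mul0r.
by move: out; rewrite -Ei -ltnS ltn_ord.
Qed.

(** The variable [y] is the ['X] of the coefficient ring: [u = 'X] yields the factor [y] of [x^3 y],
    and polynomial multiplication yields the inner sum of [fps2_mul]. *)
Lemma preimAv_gf2 (a b : {poly rat}) (stat : seq nat -> nat) (f : fps2) :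
  let wt w := 'X^(stat w) : {poly rat} in
  multiplicative_weight a b 'X wt ->
  (forall m, f 0%N m = 0) -> (forall n m, f n.+1 m = (iota_fertility wt n.+1)`_m) ->
  (fun n m => if n == 0%N then 0 else (size [seq w <- preimAv n | stat w == m])%:R) =2
  (f + fps2_XY 3 1 * (fps2_derivx f * fps2_derivx f))%fps2.
Proof.
move=> wt wtM f0 fS n m; rewrite /fps2_add fps2_mul_XY.
case: n => [|n]; first by rewrite f0 addr0.
rewrite -coef_sum_Xn (sum_preimAv_gf wtM) // coefD fS; congr (_ + _).
rewrite [in RHS]leqNgt; case: ifP => [_|ge3] /=; first by rewrite coef0.
rewrite coefXM; case: m => [|m] //=.
rewrite subn1 coef_sum /fps2_mul; apply: eq_bigr => i _.
rewrite coefM; apply: eq_bigr => j _.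
by rewrite /fps2_derivx !fS !coefMn.
Qed.

Theorem theorem9p1 :
  [/\ preim_gf =1
        (catalan_gf - fps_X 0
         + fps_X 3 * (fps_deriv catalan_gf * fps_deriv catalan_gf))%fps,
      fraka_gf =2
        (F_gf + fps2_XY 3 1 * (fps2_derivx F_gf * fps2_derivx F_gf))%fps2
    & frakb_gf =2
        (G_gf + fps2_XY 3 1 * (fps2_derivx G_gf * fps2_derivx G_gf))%fps2].
Proof.
have poly_char0 n : n.+1%:R != 0 :> {poly rat} by rewrite -polyC_natr polyC_eq0 pnatr_eq0.
have catalan0 : catalan 0 = 1 by rewrite /catalan bin0 mulr1 invr1.
split.
- have E n : iota_fertility (fun=> 1 : rat) n.+1 = catalan n.+1.
    apply: (iota_fertility_unique trivial_weight) => [k||]; first by rewrite pnatr_eq0.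
      by rewrite catalanS catalan0; field.
    exact: catalan_recurrence.
  case=> [|n]; rewrite /preim_gf /fps_add /fps_sub fps_mul_X /=.
    (* The constant term 1 of the Catalan series is cancelled by [fps_X 0]. *)
    by rewrite /catalan_gf catalan0 /fps_X eqxx subrr.
  rewrite -sum1_size natr_sum (sum_preimAv_gf trivial_weight) // E subr0 mul1r.
  rewrite [in RHS]leqNgt.
  case: ifP => //= _; congr (_ + _).
  by apply: eq_bigr => i _; rewrite !E.
- apply: (preimAv_gf2 descents_weight) => // n m.
  rewrite /F_gf /= -coef_narayana_poly
    (iota_fertility_unique (g := narayana_poly) descents_weight) //.
    apply/polyP => k; rewrite coef_narayana_poly coef1 /narayana.
    case: k => [|k] /=; first by rewrite subnn bin0 binn invr1 !mulr1.
    by rewrite bin_small // mulr0 mul0r.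
  exact: narayana_poly_recurrence.
- apply: (preimAv_gf2 peaks_weight) => // n m.
  rewrite /G_gf /= -coef_Vnum_poly
    (iota_fertility_unique (g := Vnum_poly) peaks_weight) //.
    apply/polyP => k; rewrite coef_poly coef1.
    by case: k => [|k] //=; rewrite VnumE catalan0.
  exact: Vnum_poly_recurrence.
Qed.
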